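(* Let $\Gamma$ be an abelian group, let $R$ be a $\Gamma$-graded gr-prime ring, and let $\mathfrak{a}$ be a nonzero graded (two-sided) ideal of $R$. Suppose $R$ admits two generalized homogeneous derivations $F_1$ and $F_2$ with associated homogeneous derivations $d_1\neq 0$ and $d_2\neq 0$, respectively, such that either $F_1(x)F_2(y)+xy\in Z(R)$ for all $x,y\in\mathfrak{a}$, or $F_1(x)F_2(y)-xy\in Z(R)$ for all $x,y\in\mathfrak{a}$. Then $R$ is commutative.
   Context: A ring $R$ is $\Gamma$-graded if $R=\bigoplus_{\tau\in\Gamma}R_\tau$ as additive groups with $R_\tau R_\sigma\subseteq R_{\tau\sigma}$; the set of homogeneous elements is $\mathcal{H}(R)=\bigcup_{\tau}R_\tau$. An ideal $\mathfrak{a}$ is graded if $\mathfrak{a}=\bigoplus_{\tau}(\mathfrak{a}\cap R_\tau)$. $R$ is gr-prime if for $a,b\in\mathcal{H}(R)$, $aRb=0$ implies $a=0$ or $b=0$. $Z(R)$ is the center of $R$. A homogeneous derivation is an additive map $d:R\to R$ with $d(xy)=d(x)y+xd(y)$ for all $x,y$ and $d(\mathcal{H}(R))\subseteq\mathcal{H}(R)$. A generalized homogeneous derivation with associated homogeneous derivation $d$ is an additive map $F:R\to R$ such that $F(xy)=F(x)y+xd(y)$ for all $x,y\in R$ and $F(\mathcal{H}(R))\subseteq\mathcal{H}(R)$. *)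

(* Defs.v *)
From HB Require Import structures.
From mathcomp Require Import all_boot all_algebra.

Set Implicit Arguments.
Unset Strict Implicit.
Unset Printing Implicit Defensive.

Import GRing.Theory.
Local Open Scope ring_scope.

(* Associative rings, not assumed to have a unit: MathComp's pzRingType and
   its extensions all include a unit. *)
HB.mixin Record Zmodule_isRng R of GRing.Zmodule R := {
  rng_mul : R -> R -> R;
  rng_mulA : associative rng_mul;
  rng_mulDl : left_distributive rng_mul +%R;
  rng_mulDr : right_distributive rng_mul +%R
}.

#[short(type="rngType")]
HB.structure Definition Rng := {R of GRing.Zmodule R & Zmodule_isRng R}.

Notation "x ** y" := (rng_mul x y) (at level 40, left associativity) : ring_scope.

(* An alias under which every unital ring is a rngType. *)
Definition rng_of (R : pzRingType) : Type := R.
HB.instance Definition _ (R : pzRingType) := GRing.Zmodule.copy (rng_of R) R.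
HB.instance Definition _ (R : pzRingType) :=
  Zmodule_isRng.Build (rng_of R)
    (@mulrA R) (@mulrDl R) (@mulrDr R).

Definition is_subgroup (V : zmodType) (A : V -> Prop) : Prop :=
  A 0 /\ (forall x y, A x -> A y -> A (x - y)).

(* A is the internal direct sum of the subgroups B i; the index type may be
   infinite, so the sums range over finite duplicate-free lists of indices. *)
Definition is_direct_sum (V : zmodType) (I : eqType)
    (A : V -> Prop) (B : I -> V -> Prop) : Prop :=
  [/\ forall i, is_subgroup (B i),
      forall x, A x <->
        exists (s : seq I) (f : I -> V),
          [/\ uniq s, forall i, i \in s -> B i (f i) & x = \sum_(i <- s) f i]
    & forall (s : seq I) (f : I -> V),
        uniq s -> (forall i, i \in s -> B i (f i)) ->
        \sum_(i <- s) f i = 0 -> forall i, i \in s -> f i = 0].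

(* The abelian grading group is written additively, as a zmodType. *)
Definition is_grading (Gamma : zmodType) (R : rngType)
    (Rg : Gamma -> R -> Prop) : Prop :=
  is_direct_sum (fun _ : R => True) Rg /\
  (forall tau sigma x y, Rg tau x -> Rg sigma y -> Rg (tau + sigma) (x ** y)).

Definition homogeneous (Gamma : zmodType) (R : rngType)
    (Rg : Gamma -> R -> Prop) (x : R) : Prop :=
  exists tau, Rg tau x.

Definition gr_prime (Gamma : zmodType) (R : rngType)
    (Rg : Gamma -> R -> Prop) : Prop :=
  forall a b, homogeneous Rg a -> homogeneous Rg b ->
    (forall r, a ** r ** b = 0) -> a = 0 \/ b = 0.

Definition is_ideal (R : rngType) (a : R -> Prop) : Prop :=
  is_subgroup a /\ (forall r x, a x -> a (r ** x) /\ a (x ** r)).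

Definition is_graded_ideal (Gamma : zmodType) (R : rngType)
    (Rg : Gamma -> R -> Prop) (a : R -> Prop) : Prop :=
  is_ideal a /\ is_direct_sum a (fun tau x => a x /\ Rg tau x).

Definition center (R : rngType) (x : R) : Prop := forall y, x ** y = y ** x.

Definition homogeneous_derivation (Gamma : zmodType) (R : rngType)
    (Rg : Gamma -> R -> Prop) (d : {additive R -> R}) : Prop :=
  (forall x y, d (x ** y) = d x ** y + x ** d y) /\
  (forall x, homogeneous Rg x -> homogeneous Rg (d x)).

Definition generalized_homogeneous_derivation (Gamma : zmodType) (R : rngType)
    (Rg : Gamma -> R -> Prop) (F d : {additive R -> R}) : Prop :=
  [/\ homogeneous_derivation Rg d,
      forall x y, F (x ** y) = F x ** y + x ** d y
    & forall x, homogeneous Rg x -> homogeneous Rg (F x)].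

(* Main.v *)
Require Import Defs.
From mathcomp Require Import all_boot all_algebra.
Import GRing.Theory.
Local Open Scope ring_scope.

(** Write z(x,y) for the central element F1(x)F2(y) + xy or F1(x)F2(y) - xy.
    Replacing y by yr changes it by the rule z(x,yr) = z(x,y)r + F1(x) y d2(r).
    Both z(x,yr) and z(x,y)r commute with r, hence so does F1(x) y d2(r), for
    all x, y in the ideal and all r in R
    ([derivation_term_commutes]).  Substituting xs for x and subtracting the
    same relation for the pair (x, sy) leaves x d1(s) y d2(r), which therefore
    commutes with r too.  Multiplying x on the left by t and comparing gives
      [r,t] x d1(s) y d2(r) = 0   for all x, y in the ideal, s, t in R.
    When r, s and t are homogeneous every factor is homogeneous (the grading
    group is abelian, so a commutator of homogeneous elements is homogeneous).
    Choosing s with d1(s) <> 0, gr-primeness shows that each homogeneous r with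
    d2(r) <> 0 is central ([central_of_derivation_neq0]).

    Fix a homogeneous r0 with d2(r0) <> 0.  Then r0 and d2(r0) are both
    central, and nonzero homogeneous central elements can be cancelled.  For t
    homogeneous with d2(t) = 0 and t <> 0, the product r0 t satisfies
    d2(r0 t) = d2(r0) t <> 0, so r0 t is central, and cancelling r0 makes t
    central.  Thus all homogeneous elements, and hence all elements, are
    central. *)

(** * Arithmetic in rings without unit *)

Lemma rng_mul0r (R : rngType) (x : R) : 0 ** x = 0.
Proof. by apply: (addrI (0 ** x)); rewrite -rng_mulDl !addr0. Qed.

Lemma rng_mulr0 (R : rngType) (x : R) : x ** 0 = 0.
Proof. by apply: (addrI (x ** 0)); rewrite -rng_mulDr !addr0. Qed.

Lemma rng_mulNr (R : rngType) (x y : R) : (- x) ** y = - (x ** y).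
Proof. by apply: (addrI (x ** y)); rewrite -rng_mulDl !subrr rng_mul0r. Qed.

Lemma rng_mulrN (R : rngType) (x y : R) : x ** (- y) = - (x ** y).
Proof. by apply: (addrI (x ** y)); rewrite -rng_mulDr !subrr rng_mulr0. Qed.

Lemma rng_mulBl (R : rngType) (x y z : R) : (x - y) ** z = x ** z - y ** z.
Proof. by rewrite rng_mulDl rng_mulNr. Qed.

Lemma rng_mulBr (R : rngType) (x y z : R) : x ** (y - z) = x ** y - x ** z.
Proof. by rewrite rng_mulDr rng_mulrN. Qed.

(** * Reduction to homogeneous elements *)

Lemma direct_sum_ind (V : zmodType) (I : eqType) (A : V -> Prop)
    (B : I -> V -> Prop) (P : V -> Prop) :
  is_direct_sum A B -> P 0 -> (forall x y, P x -> P y -> P (x + y)) ->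
  (forall i x, B i x -> P x) -> forall x, A x -> P x.
Proof.
case=> _ decA _ P0 PD PB x /decA [s [f [_ Bf ->]]].
rewrite big_seq; elim/big_ind: _ => // i /Bf; exact: PB.
Qed.

Lemma direct_sum_neq0 (V W : zmodType) (I : eqType) (A : V -> Prop)
    (B : I -> V -> Prop) (f : {additive V -> W}) :
  is_direct_sum A B -> (exists x, A x /\ f x <> 0) ->
  exists i x, B i x /\ f x != 0.
Proof.
case=> _ decA _ [x [/decA [s [c [_ Bc ->]]]]] fx0.
case: (boolP (has (fun i => f (c i) != 0) s)) => [/hasP [i si fci]|/hasPn f0].
  by exists i, (c i); split; first exact: Bc.
case: fx0; rewrite raddf_sum big_seq big1 // => i /f0; by rewrite negbK => /eqP.
Qed.

Lemma grading_ind (Gamma : zmodType) (R : rngType) (Rg : Gamma -> R -> Prop)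
    (P : R -> Prop) :
  is_grading Rg -> P 0 -> (forall x y, P x -> P y -> P (x + y)) ->
  (forall x, homogeneous Rg x -> P x) -> forall x, P x.
Proof.
move=> [dsR _] P0 PD Ph x; apply: (direct_sum_ind _ _ _ _ P dsR) => //.
by move=> i y Ry; apply: Ph; exists i.
Qed.

Lemma homogeneous_mul (Gamma : zmodType) (R : rngType) (Rg : Gamma -> R -> Prop)
    (x y : R) :
  is_grading Rg -> homogeneous Rg x -> homogeneous Rg y ->
  homogeneous Rg (x ** y).
Proof. by case=> _ RgM [i Rx] [j Ry]; exists (i + j); exact: RgM. Qed.

Lemma homogeneous_commutator (Gamma : zmodType) (R : rngType)
    (Rg : Gamma -> R -> Prop) (x y : R) :
  is_grading Rg -> homogeneous Rg x -> homogeneous Rg y ->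
  homogeneous Rg (x ** y - y ** x).
Proof.
case=> -[sgR _ _] RgM [i Rx] [j Ry]; exists (i + j).
apply: (sgR (i + j)).2; first exact: RgM.
by rewrite addrC; exact: RgM.
Qed.

Lemma center_of_homogeneous (Gamma : zmodType) (R : rngType)
    (Rg : Gamma -> R -> Prop) (x : R) :
  is_grading Rg -> (forall y, homogeneous Rg y -> x ** y = y ** x) -> center x.
Proof.
move=> gR; apply: (grading_ind _ _ _ (fun y => x ** y = y ** x) gR).
  by rewrite rng_mul0r rng_mulr0.
by move=> y z xy xz; rewrite rng_mulDr rng_mulDl xy xz.
Qed.

(** * Graded ideals of gr-prime rings *)

(** If b is a nonzero homogeneous element of the ideal, then p R b s q = 0 for
    every s; with s homogeneous, b s q is homogeneous, so gr-primeness
    applies to p and b s q, and then to b and q. *)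
Lemma gr_prime_ideal (Gamma : zmodType) (R : rngType) (Rg : Gamma -> R -> Prop)
    (a : R -> Prop) (p q : R) :
  is_grading Rg -> gr_prime Rg -> is_graded_ideal Rg a ->
  (exists x, a x /\ x <> 0) -> homogeneous Rg p -> homogeneous Rg q ->
  (forall x, a x -> p ** x ** q = 0) -> p = 0 \/ q = 0.
Proof.
move=> gR prR [[_ idM] dsa] a0 hp hq paq.
have [i [b [[ab Rb] b0]]] := direct_sum_neq0 _ _ _ _ _ idfun dsa a0.
have hb : homogeneous Rg b by exists i.
have [->|p0] := eqVneq p 0; [by left | right].
case: (prR b q) => // [s|b_eq0]; last by rewrite /= b_eq0 eqxx in b0.
move: s; apply: (grading_ind _ _ _ (fun s => b ** s ** q = 0) gR).
- by rewrite rng_mulr0 rng_mul0r.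
- by move=> x y bx bY; rewrite rng_mulDr rng_mulDl bx bY addr0.
move=> s hs; case: (prR p (b ** s ** q)) => // [||p_eq0].
- by apply: homogeneous_mul => //; exact: homogeneous_mul.
- move=> r; have := paq _ (idM s _ (idM r b ab).1).2.
  by rewrite !rng_mulA.
by rewrite p_eq0 eqxx in p0.
Qed.

(** The two-factor case applies to p and m y q only when y is homogeneous; the
    vanishing of m y q is additive in y, so it extends to the whole ideal. *)
Lemma gr_prime_ideal3 (Gamma : zmodType) (R : rngType)
    (Rg : Gamma -> R -> Prop) (a : R -> Prop) (p m q : R) :
  is_grading Rg -> gr_prime Rg -> is_graded_ideal Rg a ->
  (exists x, a x /\ x <> 0) ->
  homogeneous Rg p -> homogeneous Rg m -> homogeneous Rg q ->
  (forall x y, a x -> a y -> p ** x ** m ** y ** q = 0) ->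
  [\/ p = 0, m = 0 | q = 0].
Proof.
move=> gR prR ga a0 hp hm hq pamaq.
have [->|p0] := eqVneq p 0; first by constructor 1.
suff [->|->] : m = 0 \/ q = 0 by [constructor 2 | constructor 3].
apply: (gr_prime_ideal _ _ _ _ _ _ gR prR ga a0) => //.
apply: (direct_sum_ind _ _ _ _ (fun y => m ** y ** q = 0) ga.2).
- by rewrite rng_mulr0 rng_mul0r.
- by move=> x y mx mY; rewrite rng_mulDr rng_mulDl mx mY addr0.
move=> i y [ay Ry].
have hmyq : homogeneous Rg (m ** y ** q).
  apply: homogeneous_mul => //; apply: homogeneous_mul => //; by exists i.
case: (gr_prime_ideal _ _ _ _ _ _ gR prR ga a0 hp hmyq) => // [x ax|p_eq0].
  by rewrite !rng_mulA pamaq.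
by rewrite p_eq0 eqxx in p0.
Qed.

Lemma central_cancel (Gamma : zmodType) (R : rngType)
    (Rg : Gamma -> R -> Prop) (c x : R) :
  gr_prime Rg -> homogeneous Rg c -> homogeneous Rg x -> center c -> c != 0 ->
  c ** x = 0 -> x = 0.
Proof.
move=> prR hc hx cc c0 cx0.
case: (prR c x) => // [r|c_eq0]; last by rewrite c_eq0 eqxx in c0.
by rewrite cc -rng_mulA cx0 rng_mulr0.
Qed.

(** * Derivations and central elements *)

Lemma derivation_center (R : rngType) (d : {additive R -> R}) (c : R) :
  (forall x y, d (x ** y) = d x ** y + x ** d y) -> center c -> center (d c).
Proof.
move=> dM cc y; have := congr1 d (cc y).
by rewrite !dM cc [RHS]addrC => /addIr.
Qed.

(** Both c r and c r + w commute with r, hence so does their difference. *)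
Lemma commute_of_center (R : rngType) (c r w : R) :
  center c -> center (c ** r + w) -> w ** r = r ** w.
Proof.
move=> cc /(_ r); rewrite rng_mulDl rng_mulDr rng_mulA -(cc r).
exact: addrI.
Qed.

Lemma derivation_term_commutes (R : rngType) (a : R -> Prop)
    (F1 F2 d2 : {additive R -> R}) (x y r : R) :
  is_ideal a -> (forall x y, F2 (x ** y) = F2 x ** y + x ** d2 y) ->
  (forall x y, a x -> a y -> center (F1 x ** F2 y + x ** y)) \/
  (forall x y, a x -> a y -> center (F1 x ** F2 y - x ** y)) ->
  a x -> a y -> F1 x ** y ** d2 r ** r = r ** (F1 x ** y ** d2 r).
Proof.
move=> [_ idM] F2M cz ax ay; have ayr := (idM r y ay).2.
case: cz => cz; apply: (commute_of_center _ _ _ _ (cz x y ax ay)).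
- have := cz x _ ax ayr.
  by rewrite F2M rng_mulDr rng_mulDl !rng_mulA addrAC.
- have := cz x _ ax ayr.
  by rewrite F2M rng_mulDr rng_mulBl !rng_mulA addrAC.
Qed.

(** The commutation hypothesis is additive in x and y but not in r, so it is
    exploited at one fixed homogeneous r.  Substituting xs for x trades F x for
    x d(s), and left multiplication of x by t then produces the commutator
    [r,t] as the first factor of a vanishing product. *)
Lemma central_of_derivation_neq0 (Gamma : zmodType) (R : rngType)
    (Rg : Gamma -> R -> Prop) (a : R -> Prop) (F d g : {additive R -> R})
    (r : R) :
  is_grading Rg -> gr_prime Rg -> is_graded_ideal Rg a ->
  (exists x, a x /\ x <> 0) ->
  generalized_homogeneous_derivation Rg F d -> (exists x, d x <> 0) ->
  (forall x y, a x -> a y -> F x ** y ** g r ** r = r ** (F x ** y ** g r)) ->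
  homogeneous Rg r -> homogeneous Rg (g r) -> g r != 0 -> center r.
Proof.
move=> gR prR ga a0 [[_ hd] FM _] [s0 ds0] comm hr hgr gr0.
have [[_ idM] _] := ga.
have [i [s [Rs ds]]] :=
  direct_sum_neq0 _ _ _ _ _ d gR.1 (ex_intro _ s0 (conj Logic.I ds0)).
have hds : homogeneous Rg (d s) by apply: hd; exists i.
(* The difference of the relations for (x s, y) and (x, s y). *)
have commd x y : a x -> a y ->
    x ** d s ** y ** g r ** r = r ** (x ** d s ** y ** g r).
  move=> ax ay; have := comm _ y (idM s x ax).2 ay.
  have := comm x _ ax (idM s y ay).1.
  by rewrite FM !rng_mulDl rng_mulDr !rng_mulA => -> /addrI.
apply: (center_of_homogeneous _ _ _ _ gR) => t ht.
have hrt := homogeneous_commutator _ _ _ _ _ gR hr ht.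
case: (gr_prime_ideal3 _ _ _ _ _ _ _ gR prR ga a0 hrt hds hgr).
- move=> x y ax ay; rewrite !rng_mulBl.
  have := commd _ y (idM t x ax).1 ay.
  have /(congr1 (rng_mul t)) := commd x y ax ay.
  by rewrite !rng_mulA => -> ->; rewrite subrr.
- by move/eqP; rewrite subr_eq0 => /eqP.
- by move=> ds_eq0; rewrite ds_eq0 eqxx in ds.
- by move=> gr_eq0; rewrite gr_eq0 eqxx in gr0.
Qed.

(** Multiplying t by a homogeneous r0 with g(r0) <> 0 moves t off the kernel of
    g while r0, being central, can be cancelled afterwards. *)
Lemma commutative_of_central_off_kernel (Gamma : zmodType) (R : rngType)
    (Rg : Gamma -> R -> Prop) (g : {additive R -> R}) :
  is_grading Rg -> gr_prime Rg -> homogeneous_derivation Rg g ->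
  (exists x, g x <> 0) ->
  (forall r, homogeneous Rg r -> g r != 0 -> center r) ->
  forall x y : R, x ** y = y ** x.
Proof.
move=> gR prR [gM hg] [x0 gx0] cen.
have [i [r0 [Rr0 gr0]]] :=
  direct_sum_neq0 _ _ _ _ _ g gR.1 (ex_intro _ x0 (conj Logic.I gx0)).
have hr0 : homogeneous Rg r0 by exists i.
have cr0 : center r0 by exact: cen.
have cgr0 : center (g r0) by exact: derivation_center.
have r0_neq0 : r0 != 0 by apply: contraNneq gr0 => ->; rewrite raddf0.
apply: (grading_ind _ _ _ (@center R) gR) => [y|x y cx cy z|t ht].
- by rewrite rng_mul0r rng_mulr0.
- by rewrite rng_mulDl rng_mulDr cx cy.
have [gt0|] := eqVneq (g t) 0; last exact: cen.
have [t0|t_neq0] := eqVneq t 0; first by move=> y; rewrite t0 rng_mul0r rng_mulr0.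
have cr0t : center (r0 ** t).
  apply: cen; first exact: homogeneous_mul.
  rewrite gM gt0 rng_mulr0 addr0; apply: contraNneq t_neq0 => gr0t.
  by apply/eqP; apply: (central_cancel _ _ _ _ _ prR _ ht cgr0 gr0 gr0t); exact: hg.
apply: (center_of_homogeneous _ _ _ _ gR) => s hs; apply/eqP.
rewrite -subr_eq0; apply/eqP.
apply: (central_cancel _ _ _ _ _ prR hr0 _ cr0 r0_neq0).
  exact: homogeneous_commutator.
by rewrite rng_mulBr !rng_mulA cr0t (cr0 s) rng_mulA subrr.
Qed.

(** * The commutativity theorem *)

Theorem theorem4p9 (Gamma : zmodType) (R : rngType) (Rg : Gamma -> R -> Prop)
    (hgrading : is_grading Rg) (hprime : gr_prime Rg)
    (a : R -> Prop) (ha : is_graded_ideal Rg a) (ha0 : exists x, a x /\ x <> 0)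
    (F1 F2 d1 d2 : {additive R -> R})
    (hF1 : generalized_homogeneous_derivation Rg F1 d1)
    (hF2 : generalized_homogeneous_derivation Rg F2 d2)
    (hd1 : exists x, d1 x <> 0) (hd2 : exists x, d2 x <> 0)
    (hcenter :
       (forall x y, a x -> a y -> center (F1 x ** F2 y + x ** y)) \/
       (forall x y, a x -> a y -> center (F1 x ** F2 y - x ** y))) :
  forall x y : R, x ** y = y ** x.
Proof.
have [hder2 F2M _] := hF2.
apply: (commutative_of_central_off_kernel _ _ _ _ hgrading hprime hder2 hd2).
move=> r hr d2r0.
apply: (central_of_derivation_neq0 _ _ _ _ _ _ d2 _ hgrading hprime ha ha0 hF1 hd1) => //.
  by move=> x y ax ay; exact: (derivation_term_commutes _ _ _ _ _ _ _ _ ha.1 F2M hcenter).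
exact: hder2.2.
Qed.
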